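(* Let $P,\nu\in\mathcal P(\Xi)$ and consider the optimal values $$v(P)=\min_{x\in X}\{g(x)+\mathbb E_P[Q(x,\xi)]\},\qquad v(\nu)=\min_{x\in X}\{g(x)+\mathbb E_\nu[Q(x,\xi)]\}.$$ Assume: (i) (well-posedness) for every $\mu\in\mathcal P(\Xi)$ such that $\mathbb E_\mu[|Q(x,\xi)|]<\infty$ for all $x\in X$, the problem $\min_{x\in X}\{g(x)+\mathbb E_\mu[Q(x,\xi)]\}$ has an optimal solution (a minimizer with finite objective value); (ii) (integrability) for each $x\in X$, the function $\xi\mapsto Q(x,\xi)$ is measurable, and $\mathbb E_P[|Q(x,\xi)|]<\infty$ and $\mathbb E_\nu[|Q(x,\xi)|]<\infty$; (iii) (regret domination) there are a (measurable, lower semicontinuous) function $c:\Xi\times\Xi\to[0,+\infty]$ and a constant $\beta>0$ such that $$R(\xi,\xi'):=\sup_{x\in X}[Q(x,\xi)-Q(x,\xi')]\le \beta\, c(\xi,\xi')\qquad\text{for all }\xi,\xi'\in\Xi.$$ If moreover $c$ is symmetric, i.e. $c(\xi,\xi')=c(\xi',\xi)$ for all $\xi,\xi'\in\Xi$, then $$|v(P)-v(\nu)|\le\beta\,\mathcal T_c(P,\nu).$$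
   Context: $\Xi\subseteq\mathbb R^d$ is the set of scenarios, and $\mathcal P(\Xi)$ is the set of Borel probability measures on $\Xi$. The first-stage feasible set $X\subseteq\mathbb R^{n_1}$ is closed and nonempty, and $g:\mathbb R^{n_1}\to\mathbb R\cup\{+\infty\}$ is proper, lower semicontinuous and coercive. The second-stage (recourse) value function is the real-valued function $$Q(x,\xi)=\min_{z\in Z(x,\xi)}\kappa(z;x,\xi),\qquad (x,\xi)\in X\times\Xi,$$ where $Z(x,\xi)\subseteq\mathbb R^{n_2}$ is nonempty for every $(x,\xi)\in X\times\Xi$ (relatively complete recourse), the cost $\kappa:\mathbb R^{n_2}\times\mathbb R^{n_1}\times\Xi\to\mathbb R$ is measurable in $\xi$ and lower semicontinuous in $(z,x)$, and the minimum is attained. For $\mu\in\mathcal P(\Xi)$, $\mathbb E_\mu[Q(x,\xi)]=\int_\Xi Q(x,\xi)\,d\mu(\xi)$. For $\mu,\mu'\in\mathcal P(\Xi)$, $\Pi(\mu,\mu')$ is the set of couplings, i.e. Borel probability measures on $\Xi\times\Xi$ with first marginal $\mu$ and second marginal $\mu'$, and the optimal transport cost is $$\mathcal T_c(\mu,\mu')=\inf_{\pi\in\Pi(\mu,\mu')}\int_{\Xi\times\Xi}c(\xi,\xi')\,d\pi(\xi,\xi')\in[0,+\infty].$$ The cost $c$ is not assumed to satisfy the triangle inequality. *)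

(* Defs.v *)
From HB Require Import structures.
From mathcomp Require Import all_boot all_order all_algebra.
From mathcomp Require Import all_classical all_reals all_analysis.
From mathcomp Require Import measurable_realfun.
Import Order.TTheory GRing.Theory Num.Theory.
Import numFieldNormedType.Exports.

Set Implicit Arguments.
Unset Strict Implicit.
Unset Printing Implicit Defensive.

Local Open Scope classical_set_scope.
Local Open Scope ring_scope.

(* The set Xi seen as a space of its own, with the subspace topology. The
   library only has measurable structures on pointed types, whence the proof
   that Xi is nonempty; this loses nothing, since an empty Xi carries no
   probability measure. *)
Definition scenario (R : realType) (d : nat) (Xi : set 'rV[R]_d)
  (Xi0 : Xi !=set0) : Type := set_type Xi.

Section scenario_instances.
Context (R : realType) (d : nat) (Xi : set 'rV[R]_d) (Xi0 : Xi !=set0).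

HB.instance Definition _ := Topological.copy (scenario Xi0) (set_type Xi).
HB.instance Definition _ := isPointed.Build (scenario Xi0)
  (exist (fun x => x \in Xi) (projT1 (cid Xi0)) (mem_set (projT2 (cid Xi0)))).

End scenario_instances.

Notation borel T := (@g_sigma_algebraType T open).

Section transport.
Context (R : realType) (T : ptopologicalType).
Implicit Types (mu nu : probability (borel T) R) (c : T * T -> \bar R).
Local Open Scope ereal_scope.

Definition coupling mu nu : set (probability (borel (T * T)%type) R) :=
  [set pi | forall A : set (borel T), measurable A ->
     pi (fst @^-1` A) = mu A /\ pi (snd @^-1` A) = nu A].

Definition transport_cost c mu nu : \bar R :=
  ereal_inf [set \int[pi]_p c p | pi in coupling mu nu].

End transport.

Section objective_cost.
Context (R : realType) (n : nat).
Implicit Type g : 'rV[R]_n -> \bar R.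
Local Open Scope ereal_scope.

(* The first conjunct says that g takes values in R with +oo adjoined. *)
Definition proper_cost g := (forall x, g x != -oo) /\ exists x, g x < +oo.

Definition coercive_cost g :=
  forall M : R, exists r : R, forall x, (r <= `|x|)%R -> M%:E <= g x.

End objective_cost.

Section two_stage.
Context (R : realType) (n1 n2 : nat) (T : ptopologicalType).
Local Open Scope ereal_scope.

(* The recourse problem is only required to be solvable for x in X, so the
   infimum is a minimum there and is irrelevant elsewhere. *)
Definition recourse (Z : 'rV[R]_n1 -> T -> set 'rV[R]_n2)
    (kappa : 'rV[R]_n2 -> 'rV[R]_n1 -> T -> R) (x : 'rV[R]_n1) (xi : T) : R :=
  inf [set kappa z x xi | z in Z x xi].

Definition recourse_attained (X : set 'rV[R]_n1)
    (Z : 'rV[R]_n1 -> T -> set 'rV[R]_n2)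
    (kappa : 'rV[R]_n2 -> 'rV[R]_n1 -> T -> R) :=
  forall x xi, X x -> exists2 z, Z x xi z &
    forall z', Z x xi z' -> (kappa z x xi <= kappa z' x xi)%R.

Variables (X : set 'rV[R]_n1) (g : 'rV[R]_n1 -> \bar R).
Variable Q : 'rV[R]_n1 -> T -> R.
Implicit Type mu : probability (borel T) R.

Definition objective mu (x : 'rV[R]_n1) : \bar R := g x + 'E_mu[Q x].

Definition optimal_value mu : \bar R := ereal_inf [set objective mu x | x in X].

Definition is_solution mu (x : 'rV[R]_n1) :=
  [/\ X x, objective mu x \is a fin_num &
      forall y, X y -> objective mu x <= objective mu y].

Definition has_finite_recourse mu :=
  forall x, X x -> 'E_mu[fun xi => `|Q x xi|%R] < +oo.

Definition well_posed :=
  forall mu, has_finite_recourse mu -> exists x, is_solution mu x.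

Definition regret (xi xi' : T) : \bar R :=
  ereal_sup [set (Q x xi - Q x xi')%:E | x in X].

End two_stage.

(* Main.v *)
Require Import Defs.
From HB Require Import structures.
From mathcomp Require Import all_boot all_order all_algebra.
From mathcomp Require Import all_classical all_reals all_analysis.
From mathcomp Require Import measurable_realfun.
Import Order.TTheory GRing.Theory Num.Theory.
Import numFieldNormedType.Exports.

Set Implicit Arguments.
Unset Strict Implicit.
Unset Printing Implicit Defensive.

Local Open Scope classical_set_scope.
Local Open Scope ring_scope.

(** The proof compares the two objectives at one and the same first-stage
    decision [x], uniformly in [x].  A coupling [pi] of [P] and [nu] writes both
    expectations of [Q x] as integrals against the single measure [pi], so their
    difference is the [pi]-integral of [Q x xi - Q x xi'].  Regret domination
    bounds this integrand above by [beta * c (xi, xi')]; exchanging the two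
    scenarios and using the symmetry of [c] gives the same bound for its
    opposite, hence for its absolute value.  Integrating and taking the infimum
    over the couplings yields
    [|E_P (Q x) - E_nu (Q x)| <= beta * T_c (P, nu)] ([expectation_transport]).

    It remains to pass to optimal values ([optimal_value_stable]): a minimizer
    for one measure is feasible for the other problem, at a cost that differs
    by at most [beta * T_c (P, nu)].  Well-posedness provides the minimizers and
    makes both optimal values finite, so that their difference is meaningful. *)

Local Open Scope ereal_scope.

(** The Borel sets of the product are those of the product topology, so the
    coordinate projections are measurable because they are continuous. *)
Lemma continuous_borel_measurable (S T U : ptopologicalType) (f : S * T -> U) :
  continuous f ->
  measurable_fun [set: borel (S * T)%type] (f : borel (S * T)%type -> borel U).
Proof.
move=> /continuousP fcont.
apply: (@measurability _ _ (borel (S * T)%type) (borel U) setT f open) => //.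
move=> _ [V Vopen <-].
by rewrite setTI; apply: sub_sigma_algebra; exact: fcont.
Qed.

Section marginal.
Context d1 d2 (S : measurableType d1) (T : measurableType d2) (R : realType).
Variables (pi : {measure set S -> \bar R}) (mu : {measure set T -> \bar R}).
Variable phi : S -> T.
Hypothesis phi_meas : measurable_fun setT phi.
Hypothesis phi_law : forall A, measurable A -> pi (phi @^-1` A) = mu A.

Lemma integrable_marginal (f : T -> \bar R) :
  mu.-integrable setT f -> pi.-integrable setT (f \o phi).
Proof.
move=> /integrableP[mf fint]; apply/integrableP; split.
  exact: measurableT_comp.
move: fint; rewrite (eq_measure_integral (pushforward pi phi)); last first.
  by move=> A mA _; rewrite -phi_law.
rewrite ge0_integral_pushforward ?preimage_setT//.
exact: measurableT_comp.
Qed.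

Lemma integral_marginal (f : T -> \bar R) : mu.-integrable setT f ->
  \int[pi]_x f (phi x) = \int[mu]_x f x.
Proof.
move=> fint; rewrite [RHS](eq_measure_integral (pushforward pi phi)).
- have fpi := integrable_marginal fint; have [mf _] := integrableP _ _ _ fint.
  by rewrite (integral_pushforward phi_meas mf)// preimage_setT.
- by move=> A mA _; rewrite -phi_law.
Qed.

End marginal.

(** The easy half of Kantorovich duality: a test function whose increments are
    dominated by a multiple of the cost bounds the transport cost from below.
    The absolute value is taken inside the integral before [c] enters, so that
    only integrals of nonnegative functions are compared with that of [c], which
    may be infinite. *)
Lemma expectation_transport (R : realType) (T : ptopologicalType)
    (mu nu : probability (borel T) R) (c : T * T -> \bar R) (beta : R)
    (f : T -> R) :
  (forall p, 0 <= c p) -> measurable_fun [set: borel (T * T)%type] c ->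
  (0 < beta)%R ->
  mu.-integrable [set: borel T] (EFin \o f) ->
  nu.-integrable [set: borel T] (EFin \o f) ->
  (forall a b, `|f a - f b|%:E <= beta%:E * c (a, b)) ->
  `|'E_mu[f] - 'E_nu[f]| <= beta%:E * transport_cost c mu nu.
Proof.
move=> c_ge0 c_meas beta_gt0 fmu fnu f_le; rewrite unlock.
rewrite -lee_pdivrMl//; apply: le_ereal_inf_tmp => _ [pi pi_cpl <-].
rewrite lee_pdivrMl//.
have fst_meas : measurable_fun [set: borel (T * T)%type]
    (@fst T T : borel (T * T)%type -> borel T).
  by apply: (@continuous_borel_measurable T T T fst) => p; exact: cvg_fst.
have snd_meas : measurable_fun [set: borel (T * T)%type]
    (@snd T T : borel (T * T)%type -> borel T).
  by apply: (@continuous_borel_measurable T T T snd) => p; exact: cvg_snd.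
have pi_fst (A : set (borel T)) : measurable A ->
    pi ((@fst T T : borel (T * T)%type -> borel T) @^-1` A) = mu A.
  by move=> /pi_cpl[].
have pi_snd (A : set (borel T)) : measurable A ->
    pi ((@snd T T : borel (T * T)%type -> borel T) @^-1` A) = nu A.
  by move=> /pi_cpl[].
rewrite -(integral_marginal fst_meas pi_fst fmu).
rewrite -(integral_marginal snd_meas pi_snd fnu)
  -integralB_EFin//; last 2 first.
- exact: (integrable_marginal fst_meas pi_fst fmu).
- exact: (integrable_marginal snd_meas pi_snd fnu).
have diff_meas : measurable_fun [set: borel (T * T)%type]
    (fun p => (f p.1)%:E - (f p.2)%:E).
  apply: emeasurable_funB.
  - by have /integrableP[] := integrable_marginal fst_meas pi_fst fmu.
  - by have /integrableP[] := integrable_marginal snd_meas pi_snd fnu.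
apply: le_trans (le_abse_integral _ _ diff_meas) _ => //.
rewrite -ge0_integralZl//; last by rewrite lee_fin ltW.
apply: ge0_le_integral => //.
- exact: measurableT_comp diff_meas.
- exact: measurable_funeM.
- by move=> [a b] _; exact: f_le.
Qed.

Section stability.
Context (R : realType) (n : nat) (T : ptopologicalType).
Variables (X : set 'rV[R]_n) (g : 'rV[R]_n -> \bar R) (Q : 'rV[R]_n -> T -> R).
Implicit Types mu nu : probability (borel T) R.

Lemma optimal_value_solution mu x :
  is_solution X g Q mu x -> optimal_value X g Q mu = objective g Q mu x.
Proof.
move=> [Xx _ xmin]; apply/eqP; rewrite eq_le; apply/andP; split.
  by apply: ereal_inf_lbound; exists x.
by apply: le_ereal_inf_tmp => _ [y Xy <-]; exact: xmin.
Qed.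

Lemma integrable_recourse mu x : has_finite_recourse X Q mu -> X x ->
  measurable_fun [set: borel T] (Q x) ->
  mu.-integrable [set: borel T] (EFin \o Q x).
Proof.
move=> Qfin Xx mQ; apply/integrableP; split; first exact/measurable_EFinP.
by have := Qfin x Xx; rewrite unlock.
Qed.

(** A minimizer for [nu] competes in the problem for [mu].  The bound is only
    asked as an absolute value so that both orders of [mu] and [nu] can use it;
    finiteness of the expectations lets the difference be moved across. *)
Lemma optimal_value_leD mu nu (K : \bar R) x :
  is_solution X g Q nu x -> 'E_mu[Q x] \is a fin_num ->
  'E_nu[Q x] \is a fin_num -> `|'E_mu[Q x] - 'E_nu[Q x]| <= K ->
  optimal_value X g Q mu <= optimal_value X g Q nu + K.
Proof.
move=> xsol Emu Enu EK; rewrite (optimal_value_solution xsol).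
have [Xx _ _] := xsol.
apply: (@le_trans _ _ (objective g Q mu x)).
  by apply: ereal_inf_lbound; exists x.
rewrite /objective -addeA leeD2l//.
by rewrite -leeBlDl// (le_trans (lee_abs _)).
Qed.

(** Minimizers are asked for both measures because the inequality fails for finite
    [K] when both optimal values are [+oo]: then [+oo - +oo] is [-oo], whose
    absolute value is [+oo]. *)
Lemma optimal_value_stable mu nu (K : \bar R) :
  (exists x, is_solution X g Q mu x) -> (exists x, is_solution X g Q nu x) ->
  (forall x, X x -> 'E_mu[Q x] \is a fin_num) ->
  (forall x, X x -> 'E_nu[Q x] \is a fin_num) ->
  (forall x, X x -> `|'E_mu[Q x] - 'E_nu[Q x]| <= K) ->
  `|optimal_value X g Q mu - optimal_value X g Q nu| <= K.
Proof.
move=> [x xsol] [y ysol] Emu Enu EK.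
have [Xx vmu_fin _] := xsol; have [Xy vnu_fin _] := ysol.
rewrite -(optimal_value_solution xsol) in vmu_fin.
rewrite -(optimal_value_solution ysol) in vnu_fin.
have le_mu := optimal_value_leD ysol (Emu _ Xy) (Enu _ Xy) (EK _ Xy).
have le_nu : optimal_value X g Q nu <= optimal_value X g Q mu + K.
  apply: (optimal_value_leD xsol (Enu _ Xx) (Emu _ Xx)).
  by rewrite -abseN fin_num_oppeB ?Emu// addeC EK.
have [/gee0_abs ->|/ltW/lee0_abs ->] :=
  leP 0 (optimal_value X g Q mu - optimal_value X g Q nu).
  by rewrite leeBlDl.
by rewrite fin_num_oppeB// addeC leeBlDl.
Qed.

End stability.

Local Close Scope ereal_scope.

Theorem corollary4p4 (R : realType) (d n1 n2 : nat)
  (Xi : set 'rV[R]_d) (Xi0 : Xi !=set0)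
  (X : set 'rV[R]_n1) (Xclosed : closed X) (Xneq0 : X !=set0)
  (g : 'rV[R]_n1 -> \bar R) (gproper : proper_cost g)
  (glsc : lower_semicontinuous g) (gcoercive : coercive_cost g)
  (Z : 'rV[R]_n1 -> scenario Xi0 -> set 'rV[R]_n2)
  (Zneq0 : forall x xi, X x -> Z x xi !=set0)
  (kappa : 'rV[R]_n2 -> 'rV[R]_n1 -> scenario Xi0 -> R)
  (kappa_meas : forall z x,
     measurable_fun [set: borel (scenario Xi0)] (kappa z x))
  (kappa_lsc : forall xi,
     lower_semicontinuous (fun zx : 'rV[R]_n2 * 'rV[R]_n1 => (kappa zx.1 zx.2 xi)%:E))
  (kappa_min : recourse_attained X Z kappa)
  (Q := recourse Z kappa)
  (P nu : probability (borel (scenario Xi0)) R)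
  (wellposed : well_posed X g Q)
  (Qmeas : forall x, X x ->
     measurable_fun [set: borel (scenario Xi0)] (Q x))
  (QP : has_finite_recourse X Q P)
  (Qnu : has_finite_recourse X Q nu)
  (c : scenario Xi0 * scenario Xi0 -> \bar R)
  (c_ge0 : forall p, (0 <= c p)%E)
  (c_meas : measurable_fun
     [set: borel (scenario Xi0 * scenario Xi0)%type] c)
  (c_lsc : lower_semicontinuous c)
  (beta : R) (beta_gt0 : 0 < beta)
  (regret_le : forall xi xi',
     (regret X Q xi xi' <= beta%:E * c (xi, xi'))%E)
  (c_sym : forall xi xi', c (xi, xi') = c (xi', xi)) :
  (`|optimal_value X g Q P - optimal_value X g Q nu|
     <= beta%:E * transport_cost c P nu)%E.
Proof.
have Q_int mu x : has_finite_recourse X Q mu -> X x ->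
    mu.-integrable [set: borel (scenario Xi0)] (EFin \o Q x).
  by move=> Qmu Xx; exact: integrable_recourse Qmu Xx (Qmeas x Xx).
have Q_fin mu x : has_finite_recourse X Q mu -> X x ->
    ('E_mu[Q x])%E \is a fin_num.
  by move=> Qmu Xx; rewrite unlock;
    exact: integrable_fin_num (Q_int mu x Qmu Xx).
have Q_le x a b : X x -> (((Q x a - Q x b)%R)%:E <= beta%:E * c (a, b))%E.
  move=> Xx; apply: le_trans (regret_le a b).
  by apply: ereal_sup_ubound; exists x.
apply: optimal_value_stable.
- exact: wellposed.
- exact: wellposed.
- by move=> x; exact: Q_fin.
- by move=> x; exact: Q_fin.
move=> x Xx; apply: expectation_transport => //; [exact: Q_int|exact: Q_int|].
move=> a b; case: (ger0P (Q x a - Q x b)) => _; first exact: Q_le.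
by rewrite opprB c_sym; exact: Q_le.
Qed.
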